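(* Let $d\ge 1$ be an integer and let $n=3$ or $n=4$. Then there is a nonorientable regular embedding $\mathcal{N}$ of the Hamming graph $H(d,n)$ with the following properties. If $n=3$, then $\mathcal{N}$ has genus $(2d-3)3^{d-1}+2$ and type $\{6,2d\}_m$, where $m=2d$ if $d$ is even and $m=3d$ if $d$ is odd. If $n=4$, then $\mathcal{N}$ has genus $(3d-4)4^{d-1}+2$ and type $\{4,3d\}_{3d}$. In both cases the automorphism group of $\mathcal{N}$ is a semidirect product of an elementary abelian normal subgroup of order $n^d$, acting regularly on the vertices, by a dihedral group of order $2d(n-1)$ which fixes a vertex and acts naturally on the $d(n-1)$ neighbours of that vertex.
   Context: The Hamming graph $H(d,n)$ has vertex set $\{0,1,\dots,n-1\}^d$, with two vertices adjacent if and only if they differ in exactly one coordinate. A map is a 2-cell embedding of a connected graph $K$, with edge set $E$, in a compact connected surface $S$ without boundary. Its flags are its mutually incident vertex-edge-face triples, understood topologically, i.e. the $4|E|$ triangles of the barycentric subdivision of the map (each edge lies in exactly 4 flags). An automorphism of a map is a permutation of its flags that preserves the three relations of differing only in the vertex, only in the edge, or only in the face. The map is regular if its automorphism group acts regularly on flags (equivalently, has order $4|E|$). A regular embedding of $K$ is an embedding of $K$ that gives a regular map; it is nonorientable if $S$ is nonorientable. The genus of a nonorientable map is $2-\chi$, where $\chi$ is the Euler characteristic of $S$. A regular map has type $\{p,q\}_r$ if $p$ is its covalency (the number of sides of each face), $q$ is the valency of each vertex, and $r$ is its Petrie length (the length of each Petrie polygon, i.e. of each closed zig-zag walk turning alternately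 first left and first right). Equivalently, for a flag $(v,e,f)$ let $\lambda,\rho,\tau$ be the automorphisms sending it to the flag adjacent to it differing only in $v$, only in $e$, only in $f$ respectively; then $p,q,r$ are the orders of $\lambda\rho$, $\rho\tau$ and $\lambda\rho\tau$. The natural action of the dihedral group of order $2k$ (here $k=d(n-1)$) is its action on $k$ points as on the vertices of a regular $k$-gon (for $k=2$ this action of the Klein four-group on 2 points is not faithful). *)

(* Defs.v *)
From mathcomp Require Import all_boot all_order all_algebra all_fingroup all_solvable.

Set Implicit Arguments.
Unset Strict Implicit.
Unset Printing Implicit Defensive.

Import GroupScope.

(* A map on a compact connected surface without boundary, given by its flags.
   vflip, eflip and fflip send a flag to the flag that differs from it only in
   the vertex, only in the edge, only in the face.  The last axiom on the flips
   says that every edge lies in exactly 4 flags.  These are permutations of the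
   flags, not automorphisms of the map. *)
Record surface_map := SurfaceMap {
  flag :> finType;
  vflip : {perm flag};
  eflip : {perm flag};
  fflip : {perm flag};
  vflipK : involutive vflip;
  eflipK : involutive eflip;
  fflipK : involutive fflip;
  vflip_neq : forall x, vflip x != x;
  eflip_neq : forall x, eflip x != x;
  fflip_neq : forall x, fflip x != x;
  vfflipC : forall x, vflip (fflip x) = fflip (vflip x);
  vfflip_neq : forall x, vflip (fflip x) != x;
  map_connected :
    [transitive <<[set vflip; eflip; fflip]>>, on [set: flag] | 'P]
}.

Section Maps.
Variable M : surface_map.

(* Vertices, edges and faces are identified with their sets of flags. *)
Definition vertices : {set {set M}} :=
  [set orbit 'P <<[set eflip M; fflip M]>> x | x : M].
Definition edges : {set {set M}} :=
  [set orbit 'P <<[set vflip M; fflip M]>> x | x : M].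
Definition faces : {set {set M}} :=
  [set orbit 'P <<[set vflip M; eflip M]>> x | x : M].

Definition ends (E : {set M}) : {set {set M}} :=
  [set u in vertices | ~~ [disjoint u & E]].

Definition neighbours (u : {set M}) : {set {set M}} :=
  [set w in vertices | (w != u) && [exists E in edges, ends E == [set u; w]]].

Definition euler_char : int :=
  (Posz #|vertices| - Posz #|edges| + Posz #|faces|)%R.

Definition nonorientable_genus : int := (2%:Z - euler_char)%R.

(* Adjacent triangles of the barycentric subdivision, labelled by vertex, edge
   and face, are coherently oriented iff they get opposite signs. *)
Definition orientable : Prop :=
  exists o : M -> bool, forall x,
    [/\ o (vflip M x) = ~~ o x, o (eflip M x) = ~~ o x
      & o (fflip M x) = ~~ o x].

Definition map_aut : {set {perm M}} :=
  [set s : {perm M} | [forall x, [&& s (vflip M x) == vflip M (s x),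
                                     s (eflip M x) == eflip M (s x)
                                   & s (fflip M x) == fflip M (s x)]]].

Lemma map_aut_group_set : group_set map_aut.
Proof.
apply/group_setP; split=> [|s t].
  by rewrite inE; apply/forallP=> x; rewrite !perm1 !eqxx.
rewrite !inE => /forallP hs /forallP ht; apply/forallP=> x; rewrite !permM.
have /and3P[/eqP-> /eqP-> /eqP->] := hs x.
exact: ht.
Qed.
Canonical map_aut_group := Group map_aut_group_set.

(* One step around the face, around the vertex and along the Petrie polygon
   is vflip then eflip, eflip then fflip, and vflip then eflip then fflip
   (products of permutations are read from left to right). *)
Definition has_type (p q r : nat) : Prop :=
  forall x : M,
    [/\ #|porbit (vflip M * eflip M) x| = p,
        #|porbit (eflip M * fflip M) x| = q
      & #|porbit (vflip M * eflip M * fflip M) x| = r].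

(* M is an embedding of the simple graph (T, adj): h identifies the vertices,
   and E |-> ends E is then a bijection from the edges of the map to those of
   the graph. *)
Definition embedding_of (T : finType) (adj : rel T) : Prop :=
  exists h : T -> {set M},
    [/\ injective h,
        [set h a | a : T] = vertices,
        {in edges &, injective ends}
      & [set ends E | E in edges]
          = [set [set h ab.1; h ab.2] | ab : T * T & adj ab.1 ab.2]].

End Maps.
Arguments neighbours : clear implicits.

Definition acts_regularly (aT : finGroupType) (sT : finType)
    (to : {action aT &-> sT}) (G : {set aT}) (S : {set sT}) : Prop :=
  [transitive G, on S | to] /\ {in S, forall x, 'C_G[x | to] = 1}.

Definition regular_map (M : surface_map) : Prop :=
  acts_regularly 'P (map_aut M) [set: M].

(* G is dihedral of order 2k and acts on S as on the vertices 0, ..., k-1 of a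
   regular k-gon, through the rotation i |-> i+1 mod k and the reflection
   i |-> k-1-i.  For k = 2 the action is not faithful, hence the relations. *)
Definition natural_dihedral_action (aT : finGroupType) (sT : finType)
    (to : {action aT &-> sT}) (G : {group aT}) (S : {set sT}) (k : nat) : Prop :=
  G \isog [set: 'D_(2 * k)] /\
  exists (rot ref : aT) (w : 'I_k -> sT),
    [/\ G :=: <<[set rot; ref]>>,
        [/\ #[rot] = k, #[ref] = 2 & rot ^ ref = rot^-1],
        injective w /\ [set w i | i : 'I_k] = S,
        forall i, to (w i) rot = w (ordS i)
      & forall i, to (w i) ref = w (rev_ord i)].

Definition hamming (d n : nat) : rel {ffun 'I_d -> 'I_n} :=
  fun a b => #|[set i | a i != b i]| == 1%N.
Arguments hamming : clear implicits.

(* Main.v *)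
Require Import Defs.
From mathcomp Require Import all_boot all_order all_algebra all_fingroup.
From mathcomp Require Import all_solvable all_field.
From mathcomp Require Import zify ring.

(** Why the theorem is true.  Let F be the field with n elements, om a generator
    of its multiplicative group and V = F^d, and put k = d(n-1).  Two vectors of
    V are adjacent in H(d,n) exactly when they differ by a vector a e_j with
    a != 0; these k vectors, the spokes, are listed cyclically as

      e_0, ..., e_(d-1), om e_0, ..., om e_(d-1), om^2 e_0, ...

    The linear map rotV sends each spoke to the next one.  The reversal
    i |-> k-1-i of the cycle is also induced by an additive map of V (refV), but
    only because inversion is additive on F: on its nonzero elements it is the
    identity for n = 3 and the Frobenius map for n = 4.  Hence V together with
    the dihedral group of order 2k acts on triples (v, i, s) with v in V, i
    modulo k and s a side; these triples are the flags, and the action is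
    regular.  The dihedral group is made to act on i and s as well as on V
    because for d = 1, n = 3 its action on V is not faithful.

    Turning around a vertex changes i by 1 in the direction given by s, and
    takes two flips of flags.  Travelling along an edge takes one flip; it sends
    (v, i, s) to (v + spoke i, i', s), where spoke i' = - spoke i, so that
    i' = i + cd with om^c = -1.  Three spokes with sum 0, which exist because
    |F| > 2, thus give a closed walk with an odd number of flips, and the
    surface is nonorientable ([hamming_map_nonorientable]).

    In a regular map the orders of the words in the flips can be read off at a
    single flag, because the group generated by the flips acts freely
    ([monodromy_semiregular]), and the numbers of vertices, edges and faces
    follow from the type ([card_cells]).  Two steps around a face are a
    translation by a nonzero vector, so faces have 2p sides, p = char F
    ([face_covalency]).  After j steps of a Petrie walk the vertex has moved by
    the sum over l < j of (-1)^l (spoke l) and the direction by j(cd+1)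
    ([petrie_length]); splitting the sum into blocks of d terms turns it into a
    geometric sum of ratio (-1)^d om, which vanishes at different times
    according to n and to the parity of d ([sum_spoke_signed]).

    Finally the translations are the normal elementary abelian subgroup, and the
    dihedral group is its complement fixing the vertex 0; the two generate all
    automorphisms by comparing orders ([hamming_map_sdprod]). *)

Set Implicit Arguments.
Unset Strict Implicit.
Unset Printing Implicit Defensive.

Import GRing.Theory.

(** * Involutions, generated orbits and unordered pairs *)

Section Generalities.
Local Open Scope group_scope.

(** Both a and b invert z = ab, so the group is <z><a>.  The order formula
    includes a = b and ab = ba; the point is that a is never a power of z, for
    otherwise a and b would both be the unique involution of <z>, and z = 1. *)
Lemma card_gen_involutions (gT : finGroupType) (a b : gT) :
  #[a] = 2 -> #[b] = 2 -> #|<<[set a; b]>>| = (2 * #[a * b])%N.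
Proof.
move=> oa ob; set z := a * b.
have sq (x : gT) : #[x] = 2 -> x^-1 = x.
  by move=> ox; apply/eqP; rewrite eq_invg_mul -expg2 -ox expg_order.
have zJ : z ^ a = z^-1.
  by rewrite /z invMg !sq // conjgE sq // -mulgA -{1}(sq _ oa) mulKg.
have defG : <<[set a; b]>> = <[a]> <*> <[z]>.
  apply/eqP; rewrite eqEsubset gen_subG join_subG !cycle_subG; apply/and3P;
    split.
  - apply/subsetP=> x /set2P[]->; first by rewrite mem_gen // inE cycle_id.
    by rewrite -(mulKg a b) groupM ?groupV ?mem_gen // inE cycle_id ?orbT.
  - by rewrite mem_gen // set21.
  - by rewrite groupM ?mem_gen // ?set21 ?set22.
have nz : <[a]> \subset 'N(<[z]>).
  by rewrite cycle_subG; apply/normP; rewrite -cycleJ zJ cycleV.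
rewrite defG norm_joinEl // TI_cardMg -?oa // prime_TIg -?orderE ?oa //.
rewrite cycle_subG; apply/negP=> az.
have bz : b \in <[z]> by rewrite -(mulKg a b) groupM ?groupV ?cycle_id.
have /eqP ab : <[a]> == <[b]> :> {set gT}.
  by rewrite (eq_subG_cyclic (cycle_cyclic z)) ?cycle_subG // -!orderE oa ob.
have : b \in <[a]> by rewrite ab cycle_id.
rewrite cycle2g // => /set2P[b1|ba]; first by rewrite b1 order1 in ob.
move: az; rewrite /z ba -expg2 -[X in a ^+ X]oa expg_order => /cycleP[i].
rewrite expg1n => a1.
by rewrite a1 order1 in oa.
Qed.

Lemma order_involution (T : finType) (f : {perm T}) x :
  involutive f -> f x != x -> #[f] = 2.
Proof.
move=> fK fx; apply: nt_prime_order => //.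
  by apply/permP=> y; rewrite expgS expg1 permM perm1.
by apply: contraNneq fx => ->; rewrite perm1.
Qed.

Lemma orbit_gen_closed (T : finType) (A : {set {perm T}}) (x y : T) f :
  y \in orbit 'P <<A>> x -> f \in A -> f y \in orbit 'P <<A>> x.
Proof.
move=> /orbitP[g gA <-] fA; apply/orbitP; exists (g * f)%g.
  by rewrite groupM // mem_gen.
by rewrite actM.
Qed.

Lemma orbit_gen_sub (T : finType) (A : {set {perm T}}) (S : {set T}) (x : T) :
  x \in S -> (forall f y, f \in A -> y \in S -> f y \in S) ->
  orbit 'P <<A>> x \subset S.
Proof.
move=> Sx clS; rewrite acts_sub_orbit // gen_subG; apply/subsetP=> f fA.
by rewrite !inE; apply/subsetP=> y Sy; rewrite inE; apply: clS.
Qed.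

Lemma set2_eq (T : finType) (a b a' b' : T) :
  [set a; b] = [set a'; b'] -> (a = a' /\ b = b') \/ (a = b' /\ b = a').
Proof.
move=> e.
have /set2P Ha : a \in [set a'; b'] by rewrite -e set21.
have /set2P Hb : b \in [set a'; b'] by rewrite -e set22.
have /set2P Ha' : a' \in [set a; b] by rewrite e set21.
have /set2P Hb' : b' \in [set a; b] by rewrite e set22.
intuition congruence.
Qed.

End Generalities.

(** * Regular maps *)

Section RegularMaps.
Local Open Scope group_scope.
Variable M : surface_map.

Definition monodromy : {group {perm M}} :=
  <<[set vflip M; eflip M; fflip M]>>%G.

Lemma vflip_mon : vflip M \in monodromy.
Proof. by rewrite mem_gen // !inE eqxx. Qed.
Lemma eflip_mon : eflip M \in monodromy.
Proof. by rewrite mem_gen // !inE eqxx orbT. Qed.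
Lemma fflip_mon : fflip M \in monodromy.
Proof. by rewrite mem_gen // !inE eqxx !orbT. Qed.

Lemma map_autP (s : {perm M}) :
  reflect (forall x, [/\ s (vflip M x) = vflip M (s x),
                         s (eflip M x) = eflip M (s x)
                       & s (fflip M x) = fflip M (s x)])
          (s \in map_aut M).
Proof.
rewrite inE; apply: (iffP forallP) => h x.
  by have /and3P[/eqP ? /eqP ? /eqP ?] := h x.
by have [-> -> ->] := h x; rewrite !eqxx.
Qed.

Lemma map_aut_monodromyC s g x :
  s \in map_aut M -> g \in monodromy -> s (g x) = g (s x).
Proof.
move=> /map_autP autS; suff: monodromy \subset 'C[s].
  move=> /subsetP h /h; rewrite cent1E => /eqP/permP/(_ x).
  by rewrite !permM.
rewrite /= gen_subG; apply/subsetP=> f gen_f.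
rewrite cent1E; apply/eqP/permP=> y; rewrite !permM; have [hv he hf] := autS y.
by move: gen_f; rewrite !inE => /orP[/orP[]|] /eqP->.
Qed.

Lemma monodromy_trans x y : exists2 g, g \in monodromy & g x = y.
Proof.
have [g mg ->] := atransP2 (map_connected M) (in_setT x) (in_setT y).
by exists g.
Qed.

(** An automorphism that fixes a flag fixes all flags, because it commutes with
    the flips and these connect all flags; so transitivity is enough. *)
Lemma regular_of_trans :
  (forall x y, exists2 s, s \in map_aut M & s x = y) -> regular_map M.
Proof.
move=> tr_aut; split=> [|x _].
  apply/imsetP.
  have [x _] := imsetP (map_connected M); exists x => //.
  apply/setP=> y; rewrite inE; apply/esym/orbitP.
  by have [s ? <-] := tr_aut x y; exists s.
apply/trivgP/subsetP=> s /setIP[As /astab1P sx]; apply/set1P/permP=> y.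
have [g mg <-] := monodromy_trans x y; rewrite perm1 map_aut_monodromyC //.
by congr (g _).
Qed.

Hypothesis regM : regular_map M.

Lemma map_aut_trans x y : exists2 s, s \in map_aut M & s x = y.
Proof.
have [s ms ->] := atransP2 regM.1 (in_setT x) (in_setT y).
by exists s.
Qed.

Lemma card_map_aut : #|map_aut M| = #|M|.
Proof.
have [x _] := imsetP (map_connected M) => _.
rewrite -[RHS]cardsT -(atransP regM.1 x (in_setT x)) card_orbit.
by rewrite (regM.2 x) ?inE // indexg1.
Qed.

(** Every flag is an image s x with s an automorphism, and s commutes with g. *)
Lemma monodromy_semiregular g x : g \in monodromy -> g x = x -> g = 1.
Proof.
move=> mg gx; apply/permP=> y; have [s As <-] := map_aut_trans x y.
by rewrite perm1 -map_aut_monodromyC // gx.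
Qed.

Lemma monodromy_astab1 (H : {group {perm M}}) x :
  H \subset monodromy -> 'C_H[x | 'P] = 1.
Proof.
move=> /subsetP sH; apply/trivgP/subsetP=> g /setIP[/sH mg /astab1P gx].
by apply/set1P; apply: monodromy_semiregular mg gx.
Qed.

Lemma card_monodromy_orbit (H : {group {perm M}}) x :
  H \subset monodromy -> #|orbit 'P H x| = #|H|.
Proof. by move=> sH; rewrite card_orbit monodromy_astab1 // indexg1. Qed.

Lemma card_monodromy_porbit g x : g \in monodromy -> #|porbit g x| = #[g].
Proof. by move=> mg; rewrite porbitE card_monodromy_orbit ?cycle_subG. Qed.

(** Orders of words in the flips are computed by following a single flag. *)
Lemma monodromy_order g x N :
  g \in monodromy -> (forall j, (iter j g x == x) = (N %| j)) -> #[g] = N.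
Proof.
move=> mg gN; have dvdE j : (#[g] %| j) = (N %| j).
  rewrite order_dvdn -gN -permX; apply/eqP/eqP=> [->|]; first by rewrite perm1.
  by apply: monodromy_semiregular; rewrite groupX.
by apply/eqP; rewrite eqn_dvd -dvdE dvdE !dvdnn.
Qed.

Lemma card_monodromy_orbits (H : {group {perm M}}) :
  H \subset monodromy ->
  #|M| = (#|[set orbit 'P H x | x : M]| * #|H|)%N.
Proof.
move=> sH; rewrite -cardsT; apply: card_uniform_partition.
  by move=> _ /imsetP[x _ ->]; rewrite card_monodromy_orbit.
have -> : [set orbit 'P H x | x : M] = [set orbit 'P H x | x in setT].
  by apply/setP=> A; apply/imsetP/imsetP=> -[x _ ->]; exists x; rewrite ?inE.
by apply: orbit_partition; apply/actsP=> g _ x; rewrite !inE.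
Qed.

(** Each kind of cell is an orbit of a dihedral group generated by two flips,
    which acts freely: of order 2q for a vertex, 4 for an edge, 2p for a face.
*)
Lemma card_cells (p q r : nat) : has_type M p q r ->
  [/\ #|M| = (#|vertices M| * (2 * q))%N, #|M| = (#|edges M| * 4)%N
    & #|M| = (#|faces M| * (2 * p))%N].
Proof.
move=> typM; have [x _] := imsetP (map_connected M) => _.
have [[mv me] mf] := (vflip_mon, eflip_mon, fflip_mon).
have ov : #[vflip M] = 2 := order_involution (@vflipK M) (vflip_neq x).
have oe : #[eflip M] = 2 := order_involution (@eflipK M) (eflip_neq x).
have ofl : #[fflip M] = 2 := order_involution (@fflipK M) (fflip_neq x).
have ovf : #[vflip M * fflip M] = 2.
  apply: (@order_involution _ _ x) => [y|]; rewrite !permM.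
    by rewrite vfflipC fflipK vflipK.
  by rewrite -vfflipC vfflip_neq.
have sub a b : a \in monodromy -> b \in monodromy ->
    <<[set a; b]>> \subset monodromy.
  by move=> ma mb; rewrite gen_subG; apply/subsetP=> g /set2P[]->.
have [cp cq _] := typM x.
have op : #[vflip M * eflip M] = p.
  by rewrite -cp; apply/esym/card_monodromy_porbit/groupM.
have oq : #[eflip M * fflip M] = q.
  by rewrite -cq; apply/esym/card_monodromy_porbit/groupM.
split.
- rewrite (@card_monodromy_orbits <<[set eflip M; fflip M]>>%G) ?sub //=.
  by rewrite card_gen_involutions // oq.
- rewrite (@card_monodromy_orbits <<[set vflip M; fflip M]>>%G) ?sub //=.
  by rewrite card_gen_involutions // ovf.
- rewrite (@card_monodromy_orbits <<[set vflip M; eflip M]>>%G) ?sub //=.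
  by rewrite card_gen_involutions // op.
Qed.

End RegularMaps.

(** * The spokes of V and their symmetries *)

Section HammingMap.
Local Open Scope group_scope.
Local Open Scope ring_scope.

(* Dimensions and moduli are successors so that 'I_d has a zero and 'I_k is the
   ring of integers modulo k.  The order of om is m, and k is the valency. *)
Variables (F : finFieldType) (om : F) (d' m c k' : nat).
Local Notation d := d'.+1.
Local Notation k := k'.+2.
Local Notation V := 'rV[F]_d.
Local Notation I := 'I_k.
Hypothesis kE : k = (m * d)%N.
Hypothesis cardF : #|F| = m.+1.
Hypothesis om_prim : m.-primitive_root om.
Hypothesis omc : om ^+ c = -1.
Hypothesis invD : {morph (@GRing.inv F) : x y / x + y}.

Lemma om_neq0 : om != 0.
Proof.
apply: contra_eq_neq (prim_expr_order om_prim) => ->.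
by rewrite expr0n (gtn_eqF (prim_order_gt0 om_prim)) eq_sym oner_neq0.
Qed.

Lemma om_onto x : x != 0 -> {t | (t < m)%N & x = om ^+ t}.
Proof.
move=> x0; have xm : x ^+ m = 1.
  by apply: (mulfI x0); rewrite -exprS -cardF expf_card mulr1.
by have [t ->] := prim_rootP om_prim xm; exists t.
Qed.

(** Number t * d + j (with j < d) is om^t e_j.  The index is a natural number so
    that walks can be summed without reduction; only x modulo k matters. *)
Definition spoke (x : nat) : V :=
  \row_j (if j == (x %% d)%N :> nat then om ^+ (x %/ d) else 0).

Lemma spoke_addMd t x : spoke (t * d + x) = om ^+ t *: spoke x.
Proof.
apply/rowP=> j; rewrite !mxE modnMDl divnMDl // exprD.
by case: ifP => _ //; rewrite mulr0.
Qed.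

Lemma spoke_mod x : spoke (x %% k) = spoke x.
Proof.
have split_k : (x %/ k * k = m * (x %/ k) * d)%N by rewrite kE mulnCA mulnA.
rewrite [in RHS](divn_eq x k) split_k spoke_addMd exprM.
by rewrite (prim_expr_order om_prim) expr1n scale1r.
Qed.

Lemma spokeN x : spoke (x + c * d) = - spoke x.
Proof. by rewrite addnC spoke_addMd omc scaleN1r. Qed.

Lemma spoke_neq0 x : spoke x != 0.
Proof.
apply/eqP=> /rowP/(_ (inord (x %% d))); rewrite !mxE inordK ?ltn_pmod // eqxx.
by apply/eqP; rewrite expf_neq0 ?om_neq0.
Qed.

Lemma spoke_inj x y : (x < k)%N -> (y < k)%N -> spoke x = spoke y -> x = y.
Proof.
rewrite kE => ltx lty eq_xy.
have := congr1 (fun v : V => v 0 (inord (x %% d))) eq_xy.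
rewrite /= !mxE inordK ?ltn_pmod // eqxx; case: eqP => [eqm|_]; last first.
  by move/eqP; rewrite expf_eq0 (negPf om_neq0) andbF.
move/eqP; rewrite (eq_prim_root_expr om_prim) !modn_small ?ltn_divLR // =>
  /eqP eqd.
by rewrite (divn_eq x d) (divn_eq y d) eqd eqm.
Qed.

(** All nonzero multiples of basis vectors are spokes. *)
Lemma spoke_coord (j : 'I_d) (x : F) :
  x != 0 -> exists i : 'I_k, spoke i = x *: delta_mx 0 j.
Proof.
move=> /om_onto[t lt_t ->].
have lti : (t * d + j < k)%N.
  by rewrite kE; have := ltn_ord j; nia.
exists (Ordinal lti); apply/rowP=> l; rewrite !mxE /= modnMDl divnMDl //.
rewrite modn_small // divn_small // addn0 -val_eqE /=.
by case: eqP => _; rewrite ?mulr1 ?mulr0.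
Qed.

(** Spokes generate V, coordinate by coordinate; this yields connectedness. *)
Lemma spoke_ind (P : V -> Prop) :
  P 0 -> (forall v (i : 'I_k), P v -> P (v + spoke i)) -> forall v, P v.
Proof.
move=> P0 PS v; rewrite [v]row_sum_delta.
suff: forall r : seq 'I_d, P (\sum_(j <- r) v 0 j *: delta_mx 0 j) by apply.
elim=> [|j r IH]; first by rewrite big_nil.
rewrite big_cons addrC; have [->|nz] := eqVneq (v 0 j) 0;
  first by rewrite scale0r addr0.
by have [i <-] := spoke_coord j nz; apply: PS.
Qed.

Lemma spoke_diff (u v : V) :
  reflect (exists i : 'I_k, v = u + spoke i)
    (#|[set j | u 0 j != v 0 j]| == 1%N).
Proof.
apply: (iffP cards1P) => [[j uvj]|[i ->]].
  have nz : v 0 j - u 0 j != 0.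
    by have := set11 j; rewrite -uvj inE subr_eq0 eq_sym.
  have [i iE] := spoke_coord j nz; exists i; rewrite iE; apply/rowP=> l.
  rewrite !mxE /= ; have := in_set1 l j; rewrite -uvj inE.
  have [->|_] := eqVneq l j; first by rewrite mulr1 addrC subrK.
  by rewrite mulr0 addr0 => /negbFE/eqP.
exists (inord (i %% d)); apply/setP=> l; rewrite !inE !mxE -val_eqE /=.
rewrite inordK ?ltn_pmod // -{1}[u 0 l]addr0 (inj_eq (addrI _)).
case: (nat_of_ord l =P _) => _; last by rewrite eqxx.
by rewrite eq_sym expf_neq0 ?om_neq0.
Qed.

(** The shift of coordinates, with multiplication by om on wrapping around, and
    the additive map that reverses the cyclic order of the spokes. *)
Definition rotV (v : V) : V :=
  \row_j ((if j == 0 then om else 1) * v 0 (ord_pred j)).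
Definition refV (v : V) : V := \row_j (om * v 0 (rev_ord j))^-1.

Lemma rotVD u v : rotV (u + v) = rotV u + rotV v.
Proof. by apply/rowP=> j; rewrite !mxE mulrDr. Qed.

Lemma rotVZ a v : rotV (a *: v) = a *: rotV v.
Proof. by apply/rowP=> j; rewrite !mxE mulrCA. Qed.

Lemma rotV0 : rotV 0 = 0.
Proof. by apply/rowP=> j; rewrite !mxE mulr0. Qed.

Lemma refVD u v : refV (u + v) = refV u + refV v.
Proof. by apply/rowP=> j; rewrite !mxE mulrDr invD. Qed.

Lemma rotV_inj : injective rotV.
Proof.
move=> u v /rowP uv; apply/rowP=> j; have := uv (ordS j); rewrite !mxE ordSK.
by apply: mulfI; case: ifP; rewrite ?om_neq0 ?oner_neq0.
Qed.

Lemma refVK : involutive refV.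
Proof.
move=> v; apply/rowP=> j; rewrite !mxE rev_ordK invfM invrK.
by rewrite mulKf ?om_neq0.
Qed.

Lemma refV0 : refV 0 = 0.
Proof. by apply/rowP=> j; rewrite !mxE mulr0 invr0. Qed.

Lemma rotV_spoke x : rotV (spoke x) = spoke x.+1.
Proof.
rewrite (divn_eq x d) -addnS !spoke_addMd rotVZ; congr (_ *: _).
have : (x %% d < d)%N by rewrite ltn_pmod.
move: (x %% d)%N => j ltj; apply/rowP=> l;
  rewrite !mxE modn_small // divn_small //=.
rewrite expr0; have := ltn_ord l; rewrite -val_eqE /=.
have [lt_j1|] := ltnP j.+1 d; last first.
  move=> le_dj; have -> : j.+1 = d by lia.
  rewrite modnn divnn /=; case: (nat_of_ord l) => [|l'] ltl /=.
    by rewrite ?add0n modn_small //; case: eqP => [_|]; [rewrite mulr1|lia].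
  rewrite ?addSn /= -?addnS modnDr modn_small ?(ltnW ltl) //.
  by case: eqP => [|_]; [lia|rewrite mulr0].
rewrite divn_small // (modn_small lt_j1); case: (nat_of_ord l) => [|l'] ltl /=.
  by rewrite ?add0n modn_small //; case: eqP => [|_]; [lia|rewrite mulr0].
rewrite ?addSn /= -?addnS modnDr modn_small ?(ltnW ltl) // eqSS.
by case: eqP; rewrite ?mulr1 ?mulr0.
Qed.

(** With i = t d + j one has k-1-i = (m-1-t) d + (d-1-j), and
    (om * om^t)^-1 = om^(m-1-t). *)
Lemma refV_spoke (i : 'I_k) : refV (spoke i) = spoke (rev_ord i).
Proof.
have := ltn_ord i; rewrite /=; move: (nat_of_ord i) => x; rewrite kE => ltx.
apply/rowP=> j; rewrite !mxE /=.
have ltj := ltn_ord j; have ltr := ltn_pmod x (ltn0Sn d').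
have ltt : (x %/ d < m)%N by rewrite ltn_divLR.
have -> : (m * d - x.+1 = (m - (x %/ d).+1) * d + (d - (x %% d).+1))%N.
  rewrite [in LHS](divn_eq x d);
    move: (x %/ d)%N (x %% d)%N ltt ltr => q r ltq ltr.
  have [e ->] : exists e, m = (q.+1 + e)%N by exists (m - q.+1)%N; lia.
  by rewrite addKn mulnDl mulSn; lia.
rewrite modnMDl divnMDl // (@modn_small (_ - _)); last by lia.
rewrite (@divn_small (_ - _)); last by lia.
rewrite addn0 (_ : (d - j.+1 == x %% d)%N = (j == d - (x %% d).+1 :> nat)%N);
  last by lia.
case: eqP => _; last by rewrite mulr0 invr0.
apply: (mulfI (expf_neq0 (x %/ d).+1 om_neq0)).
by rewrite -exprS mulfV ?expf_neq0 ?om_neq0 // -exprD subnKC // (prim_expr_order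
  om_prim).
Qed.

(** The terms with l in the t-th block of length d are (-1)^(td) om^t times
    those of block 0. *)
Lemma sum_spoke_signed q :
  \sum_(l < q * d) (-1) ^+ l *: spoke l
    = (\sum_(t < q) ((-1) ^+ d * om) ^+ t) *: \sum_(l < d) (-1) ^+ l *: spoke l.
Proof.
elim: q => [|q IH]; first by rewrite mul0n !big_ord0 scale0r.
rewrite mulSn addnC big_split_ord /= IH (big_ord_recr q) /= scalerDl;
  congr (_ + _).
rewrite scaler_sumr; apply: eq_bigr => l _.
by rewrite spoke_addMd scalerA exprD exprMn -exprM [(d * q)%N]mulnC scalerA
  mulrAC.
Qed.

(** Coordinate 0 only receives the term l = 0. *)
Lemma sum_spoke_signed_neq0 : \sum_(l < d) (-1) ^+ l *: spoke l != 0.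
Proof.
apply/eqP=> /rowP/(_ 0); rewrite summxE (bigD1 0) //= big1 => [|l nz].
  by rewrite !mxE /= ?mod0n ?div0n ?expr0 ?mulr1 addr0; apply/eqP/oner_neq0.
rewrite !mxE modn_small //= ifN ?mulr0 // eq_sym.
by rewrite -val_eqE in nz.
Qed.

Local Notation w := spoke.

(** * The map and its automorphisms *)

Definition hamming_flag : finType := (V * I * bool)%type.

(** The direction of the same edge seen from its other end. *)
Definition opp_shift : I := (c * d)%:R.

Lemma val_addn (i : I) n : (i + n%:R : I) = ((i + n) %% k)%N :> nat.
Proof. by rewrite /= Zp_nat /= modnDmr. Qed.

Lemma natr_eq0 n : ((n%:R : I) == 0) = (k %| n)%N.
Proof. by rewrite -val_eqE /= Zp_nat. Qed.

Lemma spoke_addn (i : I) n : w (i + n%:R : I)%R = w (i + n).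
Proof. by rewrite val_addn spoke_mod. Qed.

Lemma spoke_succ (i : I) : w (i + 1 : I)%R = w i.+1.
Proof. by rewrite -[X in (i + X)%R]/(1%:R : I) spoke_addn addn1. Qed.

Lemma spoke_natr n : w (n%:R : I)%R = w n.
Proof. by rewrite Zp_nat /= spoke_mod. Qed.

Lemma spoke_opp_shift (i : I) : w (i + opp_shift : I)%R = - w i.
Proof. by rewrite spoke_addn spokeN. Qed.

Lemma opp_shiftK : opp_shift + opp_shift = 0.
Proof.
rewrite -natrD; apply/eqP; rewrite natr_eq0 kE -mulnDl dvdn_pmul2r //.
rewrite (prim_order_dvd om_prim) exprD omc.
by rewrite mulrNN mulr1.
Qed.

Lemma rev_ordE (i : I) : rev_ord i = -1 - i.
Proof.
apply/(addIr i)/val_inj; rewrite subrK /=.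
have := ltn_ord i => lti.
have -> : (k - i.+1 + i = k'.+1)%N by lia.
by rewrite (@modn_small 1) // subn1.
Qed.

(** The flag (v, i, s) lies at the vertex v, on the edge from v to v + w i, and
    on the side of this edge that faces direction i + 1 if s, i - 1 if not. *)
Definition vstep (x : hamming_flag) : hamming_flag :=
  (x.1.1 + w x.1.2, x.1.2 + opp_shift, x.2).
Definition estep (x : hamming_flag) : hamming_flag :=
  (x.1.1, if x.2 then x.1.2 + 1 else x.1.2 - 1, ~~ x.2).
Definition fstep (x : hamming_flag) : hamming_flag := (x.1.1, x.1.2, ~~ x.2).

Lemma vstepK : involutive vstep.
Proof.
move=> [[v i] s]; rewrite /vstep /= spoke_opp_shift addrK.
by rewrite -addrA opp_shiftK addr0.
Qed.
Lemma estepK : involutive estep.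
Proof. by move=> [[v i] []]; rewrite /estep /= ?addrK ?subrK. Qed.
Lemma fstepK : involutive fstep.
Proof. by move=> [[v i] []]. Qed.

Lemma vstep_neq x : vstep x != x.
Proof.
apply/eqP=> /(congr1 (fun y : hamming_flag => y.1.1)) /= /eqP.
rewrite -subr_eq0 addrAC subrr add0r; apply/negP; exact: spoke_neq0.
Qed.

Lemma side_neq (x y : hamming_flag) : y.2 = ~~ x.2 -> y != x.
Proof. by move=> xy; apply/eqP=> yx; move: xy; rewrite yx; case: (x.2). Qed.

Definition vperm := perm (inv_inj vstepK).
Definition eperm := perm (inv_inj estepK).
Definition fperm := perm (inv_inj fstepK).

Section Closed.
Variables (A : {set {perm hamming_flag}}) (x0 : hamming_flag).
Local Notation O := (orbit 'P <<A>> x0).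
Hypothesis (eA : eperm \in A) (fA : fperm \in A).

(** One flip of edge and one of face turn a flag to the next direction, so all
    directions and sides at a vertex are reached. *)
Lemma orbit_turn v (i j : I) s t : (v, i, s) \in O -> (v, j, t) \in O.
Proof.
have flip s' t' l : (v, l, s') \in O -> (v, l, t') \in O.
  have [-> //|ne] := eqVneq s' t'; move/orbit_gen_closed => /(_ _ fA).
  by rewrite permE /fstep /=; case: s' t' ne => [] [].
have next l : (v, l, true) \in O -> (v, l + 1, true) \in O.
  move/orbit_gen_closed => /(_ _ eA); rewrite permE /estep /=; exact: flip.
move=> /(flip _ true) Oi; apply: (flip true).
rewrite -[j](subrK i) -[j - i]natr_Zp addrC.
elim: (nat_of_ord _) => [|n IH]; first by rewrite addr0.
by rewrite -natr1 addrA; apply: next.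
Qed.

Lemma orbit_all (vA : vperm \in A) y : y \in O.
Proof.
case: y => [[u j] t].
have [v0 [i0 [s0 x0E]]] : exists v i s, x0 = (v, i, s).
  by case: x0 => [[v i] s]; exists v, i, s.
rewrite -[u](subrK v0).
elim/spoke_ind: (u - v0) j t => [|v i IH] j t.
  by rewrite add0r; apply: (@orbit_turn _ i0 _ s0); rewrite -x0E orbit_refl.
apply: (@orbit_turn _ (i + opp_shift) _ true).
have := orbit_gen_closed (IH i true) vA; rewrite permE /vstep /=.
by rewrite addrAC.
Qed.

End Closed.

Lemma vpermK : involutive vperm. Proof. by move=> x; rewrite !permE vstepK. Qed.
Lemma epermK : involutive eperm. Proof. by move=> x; rewrite !permE estepK. Qed.
Lemma fpermK : involutive fperm. Proof. by move=> x; rewrite !permE fstepK. Qed.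
Lemma vperm_neq x : vperm x != x. Proof. by rewrite permE vstep_neq. Qed.
Lemma eperm_neq x : eperm x != x. Proof. by rewrite permE side_neq. Qed.
Lemma fperm_neq x : fperm x != x. Proof. by rewrite permE side_neq. Qed.
Lemma vfpermC x : vperm (fperm x) = fperm (vperm x).
Proof. by rewrite !permE. Qed.
Lemma vfperm_neq x : vperm (fperm x) != x.
Proof. by rewrite !permE side_neq. Qed.
Lemma perms_transitive :
  [transitive <<[set vperm; eperm; fperm]>>%g, on [set: hamming_flag] | 'P].
Proof.
apply/imsetP; exists (0, 0, true); rewrite ?inE //; apply/setP=> y.
by rewrite inE orbit_all // !inE eqxx ?orbT.
Qed.

Definition hamming_map : surface_map :=
  SurfaceMap vpermK epermK fpermK vperm_neq eperm_neq
    fperm_neq vfpermC vfperm_neq perms_transitive.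

Lemma vflipE (x : hamming_flag) : vflip hamming_map x = vstep x.
Proof. exact: permE. Qed.
Lemma eflipE (x : hamming_flag) : eflip hamming_map x = estep x.
Proof. exact: permE. Qed.
Lemma fflipE (x : hamming_flag) : fflip hamming_map x = fstep x.
Proof. exact: permE. Qed.

Definition translate_flag (u : V) (x : hamming_flag) : hamming_flag :=
  (x.1.1 + u, x.1.2, x.2).
Definition rotate_flag (x : hamming_flag) : hamming_flag :=
  (rotV x.1.1, x.1.2 + 1, x.2).
Definition reflect_flag (x : hamming_flag) : hamming_flag :=
  (refV x.1.1, rev_ord x.1.2, ~~ x.2).

Lemma translate_inj u : injective (translate_flag u).
Proof. by move=> [[v i] s] [[v' i'] s'] [] /(@addIr V u)-> -> ->. Qed.
Lemma rotate_inj : injective rotate_flag.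
Proof.
move=> [[v i] s] [[v' i'] s'] /eqP; rewrite !xpair_eqE /=.
by case/andP=> /andP[/eqP/rotV_inj-> /eqP/(@addIr I 1)->] /eqP->.
Qed.
Lemma reflect_inj : injective reflect_flag.
Proof.
move=> [[v i] s] [[v' i'] s'] /eqP; rewrite !xpair_eqE /=.
by case/andP=> /andP[/eqP/(inv_inj refVK)-> /eqP/rev_ord_inj->] /eqP/negb_inj->.
Qed.

Definition translation u : {perm hamming_map} := perm (@translate_inj u).
Definition rotation : {perm hamming_map} := perm rotate_inj.
Definition reflection : {perm hamming_map} := perm reflect_inj.

Lemma translationE u x : translation u x = translate_flag u x.
Proof. exact: permE. Qed.
Lemma rotationE x : rotation x = rotate_flag x. Proof. exact: permE. Qed.
Lemma reflectionE x : reflection x = reflect_flag x. Proof. exact: permE. Qed.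

Lemma translation_aut u : translation u \in map_aut hamming_map.
Proof.
apply/map_autP=> -[[v i] s].
rewrite !translationE !vflipE !eflipE !fflipE; split=> //.
by rewrite /translate_flag /vstep /= addrAC.
Qed.

Lemma rotation_aut : rotation \in map_aut hamming_map.
Proof.
apply/map_autP=> -[[v i] s].
rewrite !rotationE !vflipE !eflipE !fflipE /rotate_flag /vstep /estep;
  split=> //=.
  by rewrite rotVD rotV_spoke spoke_succ addrAC.
by case: s => //=; rewrite addrAC.
Qed.

Lemma reflection_aut : reflection \in map_aut hamming_map.
Proof.
apply/map_autP=> -[[v i] s].
rewrite !reflectionE !vflipE !eflipE !fflipE /reflect_flag /vstep /estep;
  split=> //=.
  rewrite refVD refV_spoke !rev_ordE opprD (addr0_eq opp_shiftK).
  by rewrite addrA -rev_ordE.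
by case: s; rewrite /= !rev_ordE opprD ?opprK addrA.
Qed.

(** The reflection followed by the rotation changes the side of the base flag,
    powers of the rotation set its direction, and a translation its vertex. *)
Lemma hamming_map_regular : regular_map hamming_map.
Proof.
pose x0 : hamming_map := (0, 0, true).
have base (x : hamming_map) : exists2 s, s \in map_aut hamming_map & s x0 = x.
  case: x => [[v i] s].
  have [t At tE] : exists2 t, t \in map_aut hamming_map & t x0 = (0, 0, s).
    case: s; first by exists 1%g; rewrite ?group1 ?perm1.
    exists (reflection * rotation)%g;
      first by rewrite groupM ?reflection_aut ?rotation_aut.
    rewrite permM reflectionE rotationE /rotate_flag /reflect_flag /= refV0
      rotV0 rev_ordE subr0.
    by rewrite addNr.
  exists (t * rotation ^+ i * translation v)%g;
    first by rewrite !groupM ?groupX ?translation_aut ?rotation_aut.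
  rewrite !permM tE translationE;
    suff -> : (rotation ^+ i)%g (0, 0, s) = (0, i, s) :> hamming_flag.
    by rewrite /translate_flag /= add0r.
  rewrite -[in RHS](natr_Zp i); elim: (nat_of_ord i) => [|n IH].
    by rewrite expg0 perm1.
  by rewrite expgSr permM IH rotationE /rotate_flag /= rotV0 -natr1.
apply: regular_of_trans => x y; have [s As <-] := base x;
  have [t At <-] := base y.
by exists (s^-1 * t)%g; rewrite ?groupM ?groupV // permM permK.
Qed.

(** * Vertices and edges: the embedded graph *)

Definition vertex_at (u : V) : {set hamming_map} :=
  [set x : hamming_flag | x.1.1 == u].
Definition edge_at (x : hamming_flag) : {set hamming_map} :=
  [set y : hamming_flag | (y.1 == x.1) || (y.1 == (vstep x).1)].

Lemma vertex_at_inj : injective vertex_at.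
Proof.
move=> u v /setP/(_ ((u, 0, true) : hamming_flag)); rewrite !inE eqxx.
by move=> /esym/eqP.
Qed.

Lemma vertex_orbit (x : hamming_map) :
  orbit 'P <<[set eflip hamming_map; fflip hamming_map]>> x = vertex_at x.1.1.
Proof.
apply/eqP; rewrite eqEsubset; apply/andP; split.
  apply: orbit_gen_sub => [|f y /set2P[]->]; rewrite !inE //.
    by rewrite eflipE.
  by rewrite fflipE.
apply/subsetP=> -[[v j] t]; rewrite inE /= => /eqP->.
apply: (@orbit_turn _ _ _ _ _ x.1.2 _ x.2); rewrite ?set21 ?set22 //.
by rewrite -!surjective_pairing; apply: orbit_refl.
Qed.

Lemma verticesE : vertices hamming_map = [set vertex_at u | u : V].
Proof.
apply/setP=> A; apply/imsetP/imsetP=> [[x _ ->]|[u _ ->]].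
  by exists x.1.1; rewrite ?vertex_orbit.
by exists ((u, 0, true) : hamming_flag); rewrite ?vertex_orbit.
Qed.

Lemma vertex_at_vertex u : vertex_at u \in vertices hamming_map.
Proof. by rewrite verticesE imset_f. Qed.

Lemma edge_orbit (x : hamming_map) :
  orbit 'P <<[set vflip hamming_map; fflip hamming_map]>> x = edge_at x.
Proof.
apply/eqP; rewrite eqEsubset; apply/andP; split.
  apply: orbit_gen_sub => [|f y /set2P[]->]; rewrite !inE ?eqxx //.
    rewrite vflipE => /orP[] /eqP eq_y; apply/orP; [right|left]; apply/eqP.
      by rewrite /vstep eq_y.
    have : (vstep y).1 = (vstep (vstep x)).1 by rewrite [vstep y]/vstep eq_y.
    by rewrite vstepK.
  by rewrite fflipE; case: y => [[]].
set A := [set _; _]; have fA : fflip hamming_map \in A by rewrite set22.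
have vA : vflip hamming_map \in A by rewrite set21.
have xO := orbit_refl 'P <<A>> x.
have fl (y z : hamming_map) :
    y \in orbit 'P <<A>> x -> z.1 = y.1 -> z \in orbit 'P <<A>> x.
  case: y z => [a s] [b t] /= Oy ->; have [-> //|ne] := eqVneq t s.
  have := orbit_gen_closed Oy fA; rewrite fflipE.
  by case: a Oy => ? ? _; rewrite /fstep /=; case: s t ne => [] [].
apply/subsetP=> y; rewrite inE => /orP[] /eqP yE; first exact: fl yE.
by apply: (fl (vflip hamming_map x)); rewrite ?vflipE // -vflipE;
  apply: orbit_gen_closed.
Qed.

Lemma ends_edge_at (x : hamming_flag) :
  ends (edge_at x) = [set vertex_at x.1.1; vertex_at (vstep x).1.1].
Proof.
apply/setP=> A; rewrite inE in_set2 verticesE; apply/andP/orP.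
  case=> /imsetP[u _ ->] /pred0Pn[y /andP[]];
    rewrite !inE => /eqP<- /orP[] /eqP->.
    by left.
  by right.
case=> /eqP->; rewrite imset_f //; split=> //; apply/pred0Pn.
  by exists x; rewrite /= !inE !eqxx.
by exists (vstep x); rewrite /= !inE !eqxx orbT.
Qed.

Lemma edge_at_edge (x : hamming_map) : edge_at x \in edges hamming_map.
Proof. by rewrite -edge_orbit; apply: imset_f. Qed.

Lemma edgeP E :
  reflect (exists x : hamming_flag, E = edge_at x) (E \in edges hamming_map).
Proof.
apply: (iffP imsetP) => [[x _ ->]|[x ->]]; first by exists x;
  rewrite edge_orbit.
by exists x; rewrite ?edge_orbit.
Qed.

Lemma spoke_ord_inj : injective (fun i : I => w i).
Proof. by move=> i j /spoke_inj ij; apply/val_inj/ij. Qed.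

Lemma edge_at_fst (x y : hamming_flag) : x.1 = y.1 -> edge_at x = edge_at y.
Proof. by move=> xy; rewrite /edge_at /vstep xy. Qed.

Lemma edge_at_vstep (x : hamming_flag) : edge_at (vstep x) = edge_at x.
Proof. by apply/setP=> y; rewrite !inE vstepK orbC. Qed.

(** The ends v and v + w i determine the edge: read from the other end, it has
    direction i + cd. *)
Lemma ends_inj : {in edges hamming_map &, injective (@ends hamming_map)}.
Proof.
move=> _ _ /edgeP[[[u i] s] ->] /edgeP[[[v j] t] ->].
rewrite !ends_edge_at =>
  /set2_eq [] [] /vertex_at_inj /= eq_uv /vertex_at_inj /=.
  by rewrite eq_uv => /addrI/spoke_ord_inj->; apply: edge_at_fst.
rewrite eq_uv -addrA -[X in _ = X]addr0 => /addrI/eqP.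
rewrite addr_eq0 -spokeN -spoke_addn => /eqP/spoke_ord_inj eq_ji.
by rewrite -(edge_at_vstep (v, j, t)); apply: edge_at_fst;
  rewrite /vstep /= eq_ji -addrA opp_shiftK addr0.
Qed.

Lemma vertex_at_adj (u v : V) :
  (exists i : I, v = u + w i) <->
  (exists2 E, E \in edges hamming_map
     & ends E = [set vertex_at u; vertex_at v]).
Proof.
split=> [[i ->]|[_ /edgeP[[[a i] s] ->]]].
  by exists (edge_at (u, i, true)); rewrite ?edge_at_edge // ends_edge_at.
rewrite ends_edge_at => /set2_eq [] [] /vertex_at_inj /= ->
  /vertex_at_inj /= <-; first by exists i.
by exists (i + opp_shift); rewrite spoke_opp_shift addrK.
Qed.

Lemma neighbours_vertex_at u :
  neighbours hamming_map (vertex_at u) = [set vertex_at (u + w i) | i : I].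
Proof.
apply/setP=> A; rewrite inE; apply/and3P/imsetP => [[]|[i _ ->]].
  rewrite verticesE => /imsetP[v _ ->] _ /'exists_andP[E [edE /eqP endE]].
  have [|i ->] := (vertex_at_adj u v).2; first by exists E.
  by exists i.
rewrite vertex_at_vertex; split=> //.
  apply/eqP=> /vertex_at_inj/eqP; rewrite -subr_eq0 addrAC subrr add0r.
  exact/negP/spoke_neq0.
have [|E edE endE] := (vertex_at_adj u (u + w i)).1; first by exists i.
by apply/'exists_andP; exists E; rewrite edE endE.
Qed.

(** Vertices of the Hamming graph as vectors, through a numbering of F. *)
Definition fvec (f : {ffun 'I_d -> 'I_m.+1}) : V :=
  \row_j enum_val (cast_ord (esym cardF) (f j)).

Lemma fvec_bij : bijective fvec.
Proof.
exists (fun v : V => [ffun j => cast_ord cardF (enum_rank (v 0 j))]) => [f|v].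
  by apply/ffunP=> j; rewrite ffunE mxE enum_valK cast_ordKV.
by apply/rowP=> j; rewrite mxE ffunE cast_ordK enum_rankK.
Qed.

Lemma hamming_fvec f g :
  reflect (exists i : I, fvec g = fvec f + w i) (hamming d m.+1 f g).
Proof.
rewrite /hamming.
rewrite (_ : [set j | f j != g j] = [set j | fvec f 0 j != fvec g 0 j]).
  exact: spoke_diff.
apply/setP=> j; rewrite !inE !mxE.
by rewrite (inj_eq enum_val_inj) (inj_eq (@cast_ord_inj _ _ _)).
Qed.

Lemma hamming_map_embedding : embedding_of hamming_map (hamming d m.+1).
Proof.
have [fv' fvK fv'K] := fvec_bij.
exists (fun f => vertex_at (fvec f)); split.
- by move=> f g /vertex_at_inj /(can_inj fvK).
- rewrite verticesE; apply/setP=> A; apply/imsetP/imsetP=> -[x _ ->].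
    by exists (fvec x).
  by exists (fv' x); rewrite ?fv'K.
- exact: ends_inj.
apply/setP=> A; apply/imsetP/imsetP=> [[E edE ->]|[[f g] /= fg ->]].
  have /edgeP[[[v i] s] ->] := edE; rewrite ends_edge_at.
  exists (fv' v, fv' (v + w i)); rewrite ?fv'K //=.
  by rewrite inE; apply/hamming_fvec; exists i; rewrite !fv'K.
have [|E edE <-] := (vertex_at_adj (fvec f) (fvec g)).1; last by exists E.
by apply/hamming_fvec; move: fg; rewrite inE.
Qed.

Lemma setact_vertex_at (s : {perm hamming_map}) (phi : V -> V) u :
  injective phi ->
  (forall x : hamming_flag, (s x : hamming_flag).1.1 = phi x.1.1) ->
  ('P^*)%act (vertex_at u) s = vertex_at (phi u).
Proof.
move=> phi_inj sE; apply/setP=> y; rewrite -[y](permKV s).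
have -> : (s ((s^-1)%g y) \in ('P^*)%act (vertex_at u) s)
          = ((s^-1)%g y \in vertex_at u).
  exact: (mem_imset _ _ (@perm_inj _ s)).
by rewrite !inE sE (inj_eq phi_inj).
Qed.

(** * The automorphism group *)

Lemma translationD u v :
  (translation u * translation v)%g = translation (u + v).
Proof.
by apply/permP=> x; rewrite permM !translationE /translate_flag /= addrA.
Qed.

Lemma translation0 : translation 0 = 1%g.
Proof.
apply/permP=> -[[v i] s].
by rewrite translationE perm1 /translate_flag /= addr0.
Qed.

Lemma translation_inj : injective translation.
Proof.
move=> u v /permP/(_ ((0, 0, true) : hamming_flag)).
rewrite !translationE /translate_flag /= !add0r => e.
by move/(congr1 (fun x : hamming_flag => x.1.1)): e.
Qed.

Lemma translations_group_set : group_set [set translation u | u : V].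
Proof.
apply/group_setP; split=> [|_ _ /imsetP[u _ ->] /imsetP[v _ ->]].
  by rewrite -translation0 imset_f.
by rewrite translationD imset_f.
Qed.
Definition translations : {group {perm hamming_map}} :=
  Group translations_group_set.

Lemma card_translations : #|translations| = (#|F| ^ d)%N.
Proof. by rewrite card_imset ?card_mx ?mul1n //; apply: translation_inj. Qed.

Lemma setact_translation u v :
  ('P^*)%act (vertex_at u) (translation v) = vertex_at (u + v).
Proof.
by apply: (@setact_vertex_at _ (+%R^~ v)) => [|x];
  [apply: addIr|rewrite translationE].
Qed.

Lemma translations_abelem : is_abelem translations.
Proof.
have [p p_pr charp] := finPcharP F; apply/is_abelemP; exists p => //.
apply/abelemP => //; split.
  apply/centsP=> _ /imsetP[u _ ->] _ /imsetP[v _ ->].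
  by rewrite /commute !translationD addrC.
move=> _ /imsetP[u _ ->].
have -> n : (translation u ^+ n)%g = translation (u *+ n).
  by elim: n => [|n IH];
    rewrite ?mulr0n ?expg0 ?translation0 // expgSr mulrSr IH translationD.
by rewrite -scaler_nat (pcharf0 charp) scale0r translation0.
Qed.

Lemma translations_regular :
  acts_regularly 'P^* translations (vertices hamming_map).
Proof.
rewrite verticesE; split.
  apply/imsetP; exists (vertex_at 0); rewrite ?imset_f //; apply/setP=> A.
  apply/imsetP/orbitP=> [[u _ ->]|[_ /imsetP[u _ ->] <-]].
    by exists (translation u); rewrite ?imset_f // setact_translation add0r.
  by exists u; rewrite // setact_translation add0r.
move=> _ /imsetP[u _ ->]; apply/trivgP/subsetP=> _ /setIP[/imsetP[v _ ->]].
move/astab1P; rewrite setact_translation => /vertex_at_inj/eqP.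
by rewrite -subr_eq0 addrAC subrr add0r => /eqP->; rewrite translation0 set11.
Qed.

Definition flag0 : hamming_map := ((0, 0, true) : hamming_flag).

Lemma map_aut_eq (s t : {perm hamming_map}) x :
  s \in map_aut hamming_map -> t \in map_aut hamming_map -> s x = t x -> s = t.
Proof.
move=> As At stx; apply/eqP; rewrite eq_mulVg1; apply/eqP/set1gP.
rewrite -(hamming_map_regular.2 (s x) (in_setT _)) inE groupM ?groupV //.
by apply/astab1P; rewrite /= /aperm permM permK stx.
Qed.

Lemma rotationXE n (i : I) s :
  (rotation ^+ n)%g ((0, i, s) : hamming_flag) = (0, i + n%:R, s).
Proof.
elim: n => [|n IH]; first by rewrite expg0 perm1 addr0.
by rewrite expgSr permM IH rotationE /rotate_flag /= rotV0 -natr1 addrA.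
Qed.

Lemma order_rotation : #[rotation] = k.
Proof.
apply/eqP; rewrite eqn_dvd !order_dvdn; apply/andP; split.
  apply/eqP/(@map_aut_eq _ _ flag0);
    rewrite ?groupX ?rotation_aut ?group1 // perm1.
  by rewrite rotationXE add0r; congr (_, _, _); apply/eqP; rewrite natr_eq0.
rewrite -natr_eq0; have /permP/(_ flag0) := expg_order rotation.
rewrite perm1 rotationXE add0r.
by move/(congr1 (fun x : hamming_flag => x.1.2)) => /= ->.
Qed.

Lemma order_reflection : #[reflection] = 2%N.
Proof.
apply: (@order_involution hamming_map _ flag0) => [x|];
  last by rewrite reflectionE side_neq.
rewrite !reflectionE /reflect_flag /= refVK rev_ordK negbK; by case: x => -[].
Qed.

Lemma reflectionV : (reflection^-1)%g = reflection.
Proof.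
by apply/eqP; rewrite eq_invg_mul -expg2 -order_reflection expg_order.
Qed.

(** Both sides agree on the base flag, which determines an automorphism. *)
Lemma rotation_reflection : (rotation ^ reflection = rotation^-1)%g.
Proof.
apply: (@map_aut_eq _ _ flag0);
  rewrite ?groupJ ?groupV ?rotation_aut ?reflection_aut //.
apply: (@perm_inj _ rotation); rewrite permKV.
rewrite conjgE reflectionV !permM !reflectionE !rotationE /reflect_flag
  /rotate_flag /=.
rewrite !(refV0, rotV0) !rev_ordE; congr (_, _, _).
by rewrite subr0 addNr subr0 addNr.
Qed.

Definition dihedral : {group {perm hamming_map}} :=
  <<[set rotation; reflection]>>%G.

(** A generating pair of involutions gives both the order of the group and its
    isomorphism type. *)
Lemma dihedral_gen :
  dihedral :=: <<[set reflection; (reflection * rotation)%g]>>.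
Proof.
apply/eqP; rewrite eqEsubset !gen_subG; apply/andP; split;
  apply/subsetP=> x /set2P[]->.
- by rewrite -[X in X \in _](mulKg reflection rotation) groupM ?groupV ?mem_gen
  ?set21 ?set22.
- by rewrite mem_gen ?set21.
- by rewrite mem_gen ?set22.
by rewrite groupM ?mem_gen ?set21 ?set22.
Qed.

Lemma order_reflection_rotation : #[(reflection * rotation)%g] = 2%N.
Proof.
apply: nt_prime_order => //.
  by have := rotation_reflection;
    rewrite conjgE reflectionV mulgA expg2 mulgA => ->; rewrite mulVg.
apply/eqP=> /permP/(_ flag0); rewrite perm1 permM reflectionE rotationE.
by move/(congr1 (fun x : hamming_flag => x.2)).
Qed.

Lemma card_dihedral_group : #|dihedral| = (2 * k)%N.
Proof.
rewrite [dihedral : {set _}]dihedral_gen card_gen_involutions ?order_reflection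
  ?order_reflection_rotation //.
by rewrite -{1}reflectionV mulKg order_rotation.
Qed.

Lemma dihedral_isog : dihedral \isog [set: 'D_(2 * k)].
Proof.
rewrite -card_dihedral_group [dihedral : {set _}]dihedral_gen.
apply: involutions_gen_dihedral;
  rewrite ?order_reflection ?order_reflection_rotation //.
rewrite -[X in X != _]mulg1 (inj_eq (mulgI _)) eq_sym -order_gt1.
by rewrite order_rotation.
Qed.

Lemma dihedral_aut : dihedral \subset map_aut hamming_map.
Proof.
rewrite gen_subG; apply/subsetP=> x /set2P[]->; [exact: rotation_aut|].
exact: reflection_aut.
Qed.

Lemma translations_aut : translations \subset map_aut hamming_map.
Proof. by apply/subsetP=> _ /imsetP[u _ ->]; apply: translation_aut. Qed.

Lemma setact_rotation u :
  ('P^*)%act (vertex_at u) rotation = vertex_at (rotV u).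
Proof.
by apply: setact_vertex_at => [|x]; [apply: rotV_inj | rewrite rotationE].
Qed.

Lemma setact_reflection u :
  ('P^*)%act (vertex_at u) reflection = vertex_at (refV u).
Proof.
apply: setact_vertex_at => [|x]; first exact: inv_inj refVK.
by rewrite reflectionE.
Qed.

Lemma dihedral_stab : dihedral \subset 'C[vertex_at 0 | 'P^*].
Proof.
rewrite gen_subG; apply/subsetP=> s /set2P[]->; apply/astab1P.
  by rewrite setact_rotation rotV0.
by rewrite setact_reflection refV0.
Qed.

Lemma dihedral_natural :
  natural_dihedral_action 'P^* dihedral
    (neighbours hamming_map (vertex_at 0)) k.
Proof.
split; first exact: dihedral_isog.
exists rotation, reflection, (fun i => vertex_at (w i)); split=> //.
- by split; [apply: order_rotation | apply: order_reflection | apply: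
  rotation_reflection].
- split; first by move=> i j /vertex_at_inj/spoke_ord_inj.
  by rewrite neighbours_vertex_at; apply: eq_imset => i; rewrite add0r.
- by move=> i; rewrite setact_rotation rotV_spoke /= spoke_mod.
by move=> i; rewrite setact_reflection refV_spoke.
Qed.

Lemma card_hamming_map : #|hamming_map| = (#|F| ^ d * k * 2)%N.
Proof. by rewrite !card_prod card_mx card_ord card_bool mul1n. Qed.

Lemma translations_norm : dihedral \subset 'N(translations).
Proof.
rewrite gen_subG; apply/subsetP=> s sD.
rewrite inE; apply/subsetP=> _ /imsetP[_ /imsetP[u _ ->] ->].
case/set2P: sD => sE.
  have -> : (translation u ^ s)%g = translation (rotV u).
    apply: (mulgI s); rewrite conjgE mulKVg; apply/permP=> x.
    by rewrite sE !permM !translationE !rotationE /translate_flag /rotate_flag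
      /= rotVD.
  exact: imset_f.
have -> : (translation u ^ s)%g = translation (refV u).
  apply: (mulgI s); rewrite conjgE mulKVg; apply/permP=> x.
  by rewrite sE !permM !translationE !reflectionE /translate_flag /reflect_flag
    /= refVD.
exact: imset_f.
Qed.

(** A product of translations and dihedral elements has |V| * 2k elements, as
    many as there are flags, hence as there are automorphisms. *)
Lemma hamming_map_sdprod : (translations ><| dihedral = map_aut hamming_map)%g.
Proof.
have tiND : translations :&: dihedral = 1%g.
  apply/trivgP/subsetP=>
    s /setIP[/imsetP[u _ ->] /(subsetP dihedral_stab)/astab1P].
  by rewrite setact_translation add0r => /vertex_at_inj->;
    rewrite translation0 set11.
rewrite sdprodE ?translations_norm //; apply/eqP.
rewrite eqEcard mul_subG ?translations_aut ?dihedral_aut // andTb.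
rewrite TI_cardMg // card_translations card_dihedral_group.
rewrite (card_map_aut hamming_map_regular) card_hamming_map.
by rewrite -mulnA [(k * 2)%N]mulnC.
Qed.

(** * The type of the map and its nonorientability *)

Lemma order_of_iter (g : {perm hamming_map}) N :
  g \in monodromy hamming_map ->
  (forall j, (iter j g flag0 == flag0) = (N %| j)%N) ->
  forall x, #|porbit g x| = N.
Proof.
move=> mg gN x; rewrite (card_monodromy_porbit hamming_map_regular) //.
exact: (monodromy_order hamming_map_regular mg gN).
Qed.

Lemma vertex_valency x :
  #|porbit (eflip hamming_map * fflip hamming_map)%g x| = k.
Proof.
apply: order_of_iter => [|j]; first by rewrite groupM ?eflip_mon ?fflip_mon.
suff -> : iter j (eflip hamming_map * fflip hamming_map)%g flag0
          = ((0, j%:R, true) : hamming_flag).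
  by rewrite !xpair_eqE !eqxx andbT /= natr_eq0.
elim: j => //= j ->; rewrite permM eflipE fflipE /estep /fstep /=.
by rewrite -natr1.
Qed.

(** Two steps around a face are the translation by w 0 - w 1, of order p; an odd
    number of steps changes the side. *)
Lemma face_covalency p x : p \in [pchar F] ->
  #|porbit (vflip hamming_map * eflip hamming_map)%g x| = (2 * p)%N.
Proof.
move=> charp; set g := (_ * _)%g.
apply: order_of_iter => [|j]; first by rewrite groupM ?vflip_mon ?eflip_mon.
have gE (y : hamming_flag) : g y = estep (vstep y) by rewrite permM vflipE
  eflipE.
have gg v : g (g ((v, 0, true) : hamming_flag))
            = ((v + (w 0 - w 1), 0, true) : hamming_flag).
  have step_up (u : V) (i : I) :
      estep (vstep (u, i, true)) = (u + w i, i + opp_shift + 1, false) by [].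
  have step_down (u : V) (i : I) :
      estep (vstep (u, i, false)) = (u + w i, i + opp_shift - 1, true) by [].
  rewrite !gE step_up step_down add0r [opp_shift + 1 + _ - 1]addrAC addrK
    opp_shiftK.
  by rewrite [opp_shift + 1]addrC spoke_opp_shift -addrA.
have iter2 q : iter (2 * q) g flag0
               = ((q%:R *: (w 0 - w 1), 0, true) : hamming_flag).
  elim: q => [|q IH]; first by rewrite scale0r.
  by rewrite mulnS /= IH gg -natr1 scalerDl scale1r.
have w01 : w 0 - w 1 != 0.
  by rewrite subr_eq0; apply/eqP=> /(@spoke_inj 0 1 isT isT).
rewrite (divn_eq j 2) modn2 addnC iterD mulnC iter2.
case: (odd j); last first.
  rewrite /= add0n !xpair_eqE !eqxx !andbT scaler_eq0 (negPf w01) orbF.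
  by rewrite dvdn_pmul2l // (dvdn_pcharf charp).
rewrite add1n [iter _ _ _]/= gE /estep /vstep /=.
rewrite !xpair_eqE andbF;
  apply/esym/negbTE/negP=> /(dvdn_trans (dvdn_mulr p (dvdnn 2))).
by rewrite dvdn2 oddS oddM.
Qed.

(** Step l starts in direction l (cd+1) and travels along
    w (l + (lc) d) = (-1)^l w l.  As cd+1 is prime to d, the direction can only
    return when d divides the number of steps; the vertex then returns with the
    geometric sum, and the hypothesis states when both happen. *)
Lemma petrie_length r x :
  (forall q, (\sum_(t < q) ((-1) ^+ d * om) ^+ t == 0)
               && (m %| q * (c * d + 1))%N
               = (r %| q)%N) ->
  #|porbit (vflip hamming_map * eflip hamming_map * fflip hamming_map)%g x|
    = (r * d)%N.
Proof.
move=> rP; set g := (_ * _)%g.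
apply: order_of_iter => [|j];
  first by rewrite !groupM ?vflip_mon ?eflip_mon ?fflip_mon.
have -> : iter j g flag0 =
    ((\sum_(l < j) (-1) ^+ l *: w l, (j * (c * d + 1))%:R, true)
       : hamming_flag).
  elim: j => [|j /= ->]; first by rewrite big_ord0.
  rewrite !permM vflipE eflipE fflipE /fstep /estep /vstep /=.
  congr (_, _, _).
    rewrite big_ord_recr /= spoke_natr mulnDr muln1 mulnA spoke_addMd.
    by rewrite mulnC exprM omc.
  by rewrite mulSnr natrD -addrA; congr (_ + _); rewrite natrD.
rewrite !xpair_eqE andbT natr_eq0 kE.
have cop : coprime d (c * d + 1).
  by rewrite /coprime gcdnMDl gcdn1.
have [/dvdnP[q ->]|ndj] := boolP (d %| j)%N.
  rewrite dvdn_pmul2r // -rP mulnAC dvdn_pmul2r // sum_spoke_signed scaler_eq0.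
  by rewrite (negPf sum_spoke_signed_neq0) orbF.
rewrite [RHS](contraNF _ ndj); last exact/dvdn_trans/dvdn_mull.
apply: contraNF ndj => /andP[_ /(dvdn_trans (dvdn_mull m (dvdnn d)))].
by rewrite Gauss_dvdl.
Qed.

(** Turning around a vertex takes an even number of flips, so a step along any
    spoke reverses the orientation although it keeps the side; the three spokes
    1, x and -(1+x) times e_0 close up. *)
Lemma hamming_map_nonorientable : (1 < m)%N -> ~ orientable hamming_map.
Proof.
move=> m_gt1 [o oP].
have ov y := let: And3 h _ _ := oP y in h.
have oe y := let: And3 _ h _ := oP y in h.
have ofl y := let: And3 _ _ h := oP y in h.
have turn v (i j : I) :
    o ((v, i, true) : hamming_flag) = o ((v, j, true) : hamming_flag).
  have turn0 n :
      o ((v, n%:R, true) : hamming_flag) = o ((v, 0, true) : hamming_flag).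
    elim: n => // n <-; have := oe ((v, n%:R, true) : hamming_flag).
    rewrite eflipE /estep /= natr1 => oen; rewrite -[RHS]negbK -oen -ofl.
    by rewrite fflipE.
  by rewrite -(natr_Zp i) -(natr_Zp j) !turn0.
have step v (i : I) :
    o ((v + w i, 0, true) : hamming_flag) = ~~ o ((v, 0, true) : hamming_flag).
  by rewrite (turn v 0 i) -ov vflipE; apply: turn.
have [x nzx nzx1] : exists2 x : F, x != 0 & x != -1.
  have : (0 < #|~: [set (0%R : F); (-1)%R]|)%N.
    by rewrite cardsCs setCK cardF cards2 subn_gt0 ltnS (leq_ltn_trans (leq_b1
      _)).
  by case/card_gt0P=> x; rewrite !inE negb_or => /andP[]; exists x.
have [i iE] := spoke_coord 0 (oner_neq0 F).
have [j jE] := spoke_coord 0 nzx.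
have nzl : - (1 + x) != 0 by rewrite oppr_eq0 addrC addr_eq0.
have [l lE] := spoke_coord 0 nzl.
have sum0 : 0 + w i + w j + w l = 0.
  by rewrite iE jE lE add0r -!scalerDl subrr scale0r.
have : o ((0 + w i + w j + w l, 0, true) : hamming_flag)
       = ~~ o ((0, 0, true) : hamming_flag).
  by rewrite !step negbK.
by rewrite sum0; case: (o _).
Qed.

Lemma hamming_map_cells p q r : has_type hamming_map p q r ->
  [/\ #|vertices hamming_map| = (#|F| ^ d)%N,
      (#|edges hamming_map| * 4 = #|F| ^ d * k * 2)%N
    & (#|faces hamming_map| * (2 * p) = #|F| ^ d * k * 2)%N].
Proof.
move=> typ; have [_ <- <-] := card_cells hamming_map_regular typ;
  rewrite card_hamming_map.
split=> //; rewrite verticesE card_imset ?card_mx ?mul1n //;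
  exact: vertex_at_inj.
Qed.

End HammingMap.

(** * The fields with three and four elements *)

Section Fields.
Local Open Scope ring_scope.

Lemma exists_prim_root (F : finFieldType) (m : nat) :
  #|F| = m.+1 -> (0 < m)%N -> exists om : F, m.-primitive_root om.
Proof.
move=> cardF m_gt0; pose rs := enum [pred x : F | x != 0].
have /hasP[om _ om_prim] : has m.-primitive_root rs.
  apply: has_prim_root => //; rewrite ?enum_uniq //.
    apply/allP=> x; rewrite mem_enum inE unity_rootE => x0; apply/eqP.
    by apply: (mulfI x0); rewrite -exprS -cardF expf_card mulr1.
  by rewrite -cardE; have := cardC1 (0 : F); rewrite cardF /= => <-;
    apply/eq_leq/eq_card.
by exists om.
Qed.

Lemma invf_expr (F : finFieldType) (s : nat) (x : F) :
  #|F| = s.+3 -> x^-1 = x ^+ s.+1.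
Proof.
move=> cardF; have [->|x0] := eqVneq x 0; first by rewrite invr0 expr0n.
apply: (mulfI x0); rewrite mulfV // -exprS; apply: (mulfI x0).
by rewrite mulr1 -exprS -cardF expf_card.
Qed.

(** On fields with 3 and 4 elements x^-1 is x and x^2, also for x = 0. *)
Lemma invfD (F : finFieldType) :
  #|F| = 3 \/ #|F| = 4 -> {morph (@GRing.inv F) : x y / x + y}.
Proof.
move=> [] cardF x y; rewrite !(invf_expr _ cardF) //.
have char2 : 2%N \in [pchar F] by apply: (@card_finPcharP _ 2 2).
by rewrite sqrrD mulr2n (addrr_pchar2 char2) addr0.
Qed.

Lemma sum_prim_root_eq0 (F : fieldType) (z : F) r q :
  r.-primitive_root z -> (1 < r)%N -> (\sum_(t < q) z ^+ t == 0) = (r %| q)%N.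
Proof.
move=> z_prim r_gt1;
  rewrite (prim_order_dvd z_prim) -[RHS]subr_eq0 subrX1 mulf_eq0.
rewrite [z - 1 == 0](_ : _ = false) // subr_eq0 -[z]expr1 -(prim_order_dvd
  z_prim).
by rewrite dvdn1; case: r r_gt1 {z_prim} => [|[]].
Qed.

End Fields.

(** The two cases together, for any field on which inversion is additive; the
    last hypothesis is the one that computes the Petrie length r * d. *)
Lemma hamming_regular_embedding (F : finFieldType) (om : F) (d m c p r : nat) :
  (1 <= d)%N -> (1 < m)%N -> #|F| = m.+1 -> m.-primitive_root%R om ->
  (om ^+ c = -1)%R -> {morph (@GRing.inv F) : x y / (x + y)%R} ->
  p \in [pchar F]%R ->
  (forall q, (\sum_(t < q) ((-1) ^+ d * om) ^+ t == 0)%R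
               && (m %| q * (c * d + 1))
               = (r %| q)) ->
  exists M : surface_map,
    [/\ embedding_of M (hamming d m.+1) /\ regular_map M,
        ~ orientable M,
        has_type M (2 * p) (m * d) (r * d),
        [/\ #|vertices M| = m.+1 ^ d, #|edges M| * 4 = m.+1 ^ d * (m * d) * 2
          & #|faces M| * (2 * (2 * p)) = m.+1 ^ d * (m * d) * 2]
      & exists (N D : {group {perm M}}) (v : {set M}),
          [/\ (N ><| D = map_aut M)%g,
              is_abelem N /\ #|N| = m.+1 ^ d,
              acts_regularly ('P^*) N (vertices M),
              v \in vertices M /\ D \subset 'C[v | 'P^*]%g
            & natural_dihedral_action ('P^*) D (neighbours M v) (d * m)]].
Proof.
case: d => // d' _ m_gt1 cardF om_prim omc invD charp petP.
have [k' kE] : exists k', k'.+2 = m * d'.+1 by exists (m * d'.+1 - 2); nia.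
pose M := hamming_map kE cardF om_prim omc.
have typ : has_type M (2 * p) (m * d'.+1) (r * d'.+1).
  move=> x; split; [exact: face_covalency | |exact: petrie_length].
  by rewrite -[RHS]kE; apply: vertex_valency.
have [cV cE cF] := hamming_map_cells invD typ.
rewrite cardF kE in cV cE cF.
exists M; split=> //.
- by split; [apply: hamming_map_embedding | apply: hamming_map_regular].
- exact: hamming_map_nonorientable.
exists (translations kE cardF om_prim omc), (dihedral kE cardF om_prim omc).
exists (vertex_at kE cardF om_prim omc 0%R); split.
- exact: hamming_map_sdprod.
- by rewrite translations_abelem card_translations cardF.
- exact: translations_regular.
- by rewrite vertex_at_vertex dihedral_stab.
by rewrite mulnC -[X in natural_dihedral_action _ _ _ X]kE;
  apply: dihedral_natural.
Qed.

Theorem corollary2p4 (d n : nat) (hd : (1 <= d)%N) (hn : n = 3 \/ n = 4) :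
  exists M : surface_map,
    [/\ embedding_of M (hamming d n) /\ regular_map M,
        ~ orientable M,
        n = 3 ->
          nonorientable_genus M = ((2 * d%:Z - 3) * 3 ^+ (d - 1) + 2)%R /\
          has_type M 6 (2 * d) (if odd d then 3 * d else 2 * d),
        n = 4 ->
          nonorientable_genus M = ((3 * d%:Z - 4) * 4 ^+ (d - 1) + 2)%R /\
          has_type M 4 (3 * d) (3 * d)
      & exists (N D : {group {perm M}}) (v : {set M}),
          [/\ (N ><| D = map_aut M)%g,
              is_abelem N /\ #|N| = n ^ d,
              acts_regularly ('P^*) N (vertices M),
              v \in vertices M /\ D \subset 'C[v | 'P^*]%g
            & natural_dihedral_action ('P^*) D (neighbours M v) (d * (n - 1))]].
Proof.
case: hn => ->.
  (* om = -1 = om^1; the ratio (-1)^d om is 1 for odd d and -1 for even d. *)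
  have cardF : #|'F_3| = 3 by rewrite card_Fp.
  have [om om_prim] := exists_prim_root cardF isT.
  have omN : om = (-1)%R.
    have := prim_expr_order om_prim; move/eqP;
      rewrite sqrf_eq1 => /orP[/eqP om1|/eqP //].
    by have := prim_order_dvd om_prim 1; rewrite om1 expr1n eqxx.
  have [|M [emb nor typ [cV cE cF] grp]] :=
    @hamming_regular_embedding _ om d 2 1 3 (if odd d then 3 else 2) hd isT
      cardF om_prim
      omN (invfD (or_introl cardF)) (pchar_Fp (isT : prime 3)).
    move=> q; rewrite omN mulrN1 -signr_odd mul1n addn1; case: ifP => odd_d.
      rewrite opprK (eq_bigr (fun=> 1%R)) => [|t _]; last by rewrite expr1n.
      rewrite sumr_const card_ord (dvdn_pcharf (pchar_Fp (isT : prime 3)))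
        andb_idr //.
      by rewrite dvdn_mull // dvdn2 /= odd_d.
    rewrite expr0 -omN (sum_prim_root_eq0 _ om_prim) // andb_idr // => ?.
    by rewrite dvdn_mulr.
  exists M; split=> // _; split; last by case: ifP typ.
  have d1 : d = (d - 1).+1 by rewrite subn1 prednK.
  have X : 3 ^ d = 3 * 3 ^ (d - 1) by rewrite {1}d1 expnS.
  have eE : #|edges M| = 3 * (3 ^ (d - 1) * d) by nia.
  have eF : #|faces M| = 3 ^ (d - 1) * d by nia.
  rewrite /nonorientable_genus /euler_char cV eE eF X !PoszM.
  have -> : Posz (3 ^ (d - 1)) = (3 ^+ (d - 1))%R by rewrite -[LHS]natz natrX.
  ring.
(* Here -1 = 1 = om^0, and the ratio is om itself. *)
have [F _ cardF] := pPrimePowerField (isT : prime 2) (isT : 0 < 2).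
have char2 : 2 \in [pchar F]%R by apply: (@card_finPcharP _ 2 2).
have [om om_prim] := exists_prim_root cardF isT.
have [|M [emb nor typ [cV cE cF] grp]] :=
  @hamming_regular_embedding _ om d 3 0 2 3 hd isT cardF om_prim
    (esym (oppr_pchar2 char2 1%R)) (invfD (or_intror cardF)) char2.
  move=> q; rewrite (oppr_pchar2 char2) expr1n mul1r mul0n addn1 muln1.
  by rewrite (sum_prim_root_eq0 _ om_prim) // andbb.
exists M; split=> // _; split=> //.
have d1 : d = (d - 1).+1 by rewrite subn1 prednK.
have X : 4 ^ d = 4 * 4 ^ (d - 1) by rewrite {1}d1 expnS.
have eE : #|edges M| = 6 * (4 ^ (d - 1) * d) by nia.
have eF : #|faces M| = 3 * (4 ^ (d - 1) * d) by nia.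
rewrite /nonorientable_genus /euler_char cV eE eF X !PoszM.
have -> : Posz (4 ^ (d - 1)) = (4 ^+ (d - 1))%R by rewrite -[LHS]natz natrX.
ring.
Qed.
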